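(* Let $m\ge2$ and let $f\in\mathcal{O}_0^K$ have the form $f(x)=x+x^m+\mu x^{2m-1}+\sum_{n=2m}^\infty a_nx^n$. Let $V(x)=\dfrac{x^m}{1-(\mu-\frac m2)x^{m-1}}\dfrac{\partial}{\partial x}$, with flow $\{T_V^t\}_{t\in K}$, and let $h\in\mathcal{O}_0^K$ be tangent to the identity with $h\circ f\circ h^{-1}=T_V^1$. Then $$Z_A(f)=\{\,h^{-1}\circ T_V^t\circ h : t\in K\,\}.$$
   Context: $K$ is a field of characteristic $0$, complete with respect to a nontrivial non-archimedean absolute value. $\mathcal{O}_0^K$ is the ring of power series in $K[[x]]$ with positive radius of convergence about $0$. A power series is tangent to the identity if it has the form $x+O(x^2)$. $Z_A(f)=\{g\in\mathcal{O}_0^K: g(0)=0,\ g'(0)=1,\ g\circ f=f\circ g\}$ is the analytic centralizer. For $V=v(x)\frac{\partial}{\partial x}$ with $v\in x^2K[[x]]$, the flow $T_V^t(x)=\sum_{n\ge1}a_n(t)x^n$ is the unique solution with $a_n(t)\in K[t]$ of $\frac{d}{dt}T_V^t(x)=v(T_V^t(x))$, $T_V^0(x)=x$ (formal differentiation in $t$). *)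

(* Defs.v *)
From mathcomp Require Import all_boot all_order all_algebra.
From mathcomp Require Import boolp classical_sets reals.

Set Implicit Arguments.
Unset Strict Implicit.
Unset Printing Implicit Defensive.

Import Order.TTheory GRing.Theory Num.Theory.
Local Open Scope ring_scope.

Record nonarch_absval (K : fieldType) (R : realType) (abs : K -> R) : Prop :=
  NonarchAbsval {
    absval_ge0 : forall x, 0 <= abs x;
    absval_eq0 : forall x, abs x = 0 <-> x = 0;
    absvalM : forall x y, abs (x * y) = abs x * abs y;
    absvalD : forall x y, abs (x + y) <= Num.max (abs x) (abs y)
  }.

Definition nontrivial_absval (K : fieldType) (R : realType) (abs : K -> R) :=
  exists2 x : K, x != 0 & abs x != 1.

Definition absval_cvg (K : fieldType) (R : realType) (abs : K -> R)
    (u : nat -> K) (l : K) :=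
  forall e : R, 0 < e ->
    exists N : nat, forall n, (N <= n)%N -> abs (u n - l) < e.

Definition absval_cauchy (K : fieldType) (R : realType) (abs : K -> R)
    (u : nat -> K) :=
  forall e : R, 0 < e ->
    exists N : nat,
      forall i j, (N <= i)%N -> (N <= j)%N -> abs (u i - u j) < e.

Definition absval_complete (K : fieldType) (R : realType) (abs : K -> R) :=
  forall u : nat -> K, absval_cauchy abs u -> exists l : K, absval_cvg abs u l.

(* A formal power series is its sequence of coefficients. *)
Definition fps (A : Type) := nat -> A.

Section FormalPowerSeries.
Variable A : comNzRingType.
Implicit Types f g h : fps A.

Definition fps_Xn (k : nat) : fps A := fun n => (n == k)%:R.

Definition fps_X : fps A := fps_Xn 1.

Definition fps_mul f g : fps A := fun n => \sum_(i < n.+1) f i * g (n - i)%N.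

Definition fps_exp f (k : nat) : fps A := iter k (fps_mul f) (fps_Xn 0).

(* f \o g; the truncation of the sum at k = n is harmless, and the definition
   is meaningful, only when g 0 = 0. *)
Definition fps_comp f g : fps A :=
  fun n => \sum_(k < n.+1) f k * fps_exp g k n.

Definition tangent_to_id f := f 0%N = 0 /\ f 1%N = 1.

Definition fps_comp_inverse h hinv :=
  [/\ hinv 0%N = 0, fps_comp h hinv = fps_X & fps_comp hinv h = fps_X].

End FormalPowerSeries.

Arguments fps_X {A}.

(* O_0^K: the series f converges on some disc |z| < r with r > 0. *)
Definition analytic (K : fieldType) (R : realType) (abs : K -> R)
    (f : fps K) :=
  exists2 r : R, 0 < r &
    forall z : K, abs z < r ->
      exists l : K, absval_cvg abs (fun N => \sum_(i < N) f i * z ^+ i) l.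

Definition analytic_centralizer (K : fieldType) (R : realType) (abs : K -> R)
    (f : fps K) : set (fps K) :=
  [set g | [/\ analytic abs g, tangent_to_id g
             & fps_comp g f = fps_comp f g]].

(* T is the flow of v(x) d/dx: a series in x with coefficients in K[t],
   where ^`() is the derivative in t. *)
Definition is_flow (K : fieldType) (v : fps K) (T : fps {poly K}) :=
  [/\ T 0%N = 0,
      forall n, (T n)^`() = fps_comp (fun k => (v k)%:P) T n
    & forall n, (T n).[0] = (fps_X : fps K) n].

Definition flow_at (K : fieldType) (T : fps {poly K}) (t : K) : fps K :=
  fun n => (T n).[t].

(* Main.v *)
(* Conjugating by [h] reduces the claim to the centralizer of [F = T^1].
   Algebraically: uniqueness for the flow equation gives [T^s o T^t = T^(s+t)],
   so every [T^t] commutes with [F]; conversely, since [F = x + x^m + ...], a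
   series tangent to the identity and commuting with [F] is determined by its
   coefficient at [x^m], which for [T^t] is [t].
   Analytically: a tangent series [f] converges near 0 iff
   [|f_(n+1)| <= B^n] for some [B], and for fixed [B] such series are closed
   under composition and inversion.  For the flow, measure a polynomial in [t]
   by the maximum of [|k! p_k| rho^k]: this norm is submultiplicative, and
   integration in [t] costs only a factor [rho], so by the flow equation the
   n-th coefficient has norm at most [B^(n-1)]; as [|k!| >= c^k] for some
   [c > 0], a large [rho] makes this a bound on the values at any given [t]. *)
Require Import Defs.
From mathcomp Require Import all_boot all_order all_algebra.
From mathcomp Require Import boolp classical_sets reals.
From mathcomp Require Import ring lra zify.

Set Implicit Arguments.
Unset Strict Implicit.
Unset Printing Implicit Defensive.

Import Order.TTheory GRing.Theory Num.Theory.
Local Open Scope ring_scope.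

(** * Composition of formal power series, through polynomial truncations *)

Section Truncation.
Variable A : comNzRingType.
Implicit Types (f g h : fps A) (p q r s : {poly A}).

(** Polynomials already carry powers and an associative composition; identities between series are
    checked on truncations, one coefficient at a time. *)
Definition trunc N f : {poly A} := \poly_(i < N) f i.

Lemma coef_trunc N f i : (i < N)%N -> (trunc N f)`_i = f i.
Proof. by move=> iN; rewrite coef_poly iN. Qed.

Lemma coef_exp_trunc N f k n : (n < N)%N -> (trunc N f ^+ k)`_n = fps_exp f k n.
Proof.
elim: k n => [|k IHk] n nN; first by rewrite expr0 coef1.
rewrite exprS coefM /= /fps_mul; apply: eq_bigr => i _.
by rewrite coef_trunc ?IHk //; have := ltn_ord i; lia.
Qed.

Lemma fps_exp_eq0 f k n : f 0%N = 0 -> (n < k)%N -> fps_exp f k n = 0.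
Proof.
move=> f0; elim: k n => // k IHk n nk; rewrite /= /fps_mul big1 // => i _.
case: (posnP i) => [->|i_gt0]; first by rewrite f0 mul0r.
by rewrite IHk ?mulr0 //; have := ltn_ord i; lia.
Qed.

(** As [g 0 = 0], the power [g ^ k] starts in degree [k], so only the terms with [k <= n] reach
    degree [n]. *)
Lemma coef_comp_trunc N f g n : g 0%N = 0 -> (n < N)%N ->
  (trunc N f \Po trunc N g)`_n = fps_comp f g n.
Proof.
move=> g0 nN; rewrite [trunc N f]/trunc poly_def linear_sum coef_sum /=.
rewrite -(subnKC nN) big_split_ord /= addrC big1 ?add0r => [|i _]; last first.
  rewrite linearZ /= comp_Xn_poly coefZ coef_exp_trunc; last by lia.
  by rewrite fps_exp_eq0 ?mulr0 //; lia.
rewrite /fps_comp; apply: eq_bigr => i _.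
by rewrite linearZ /= comp_Xn_poly coefZ coef_exp_trunc //; lia.
Qed.

Lemma comp_polyD_dvd p q r : exists s, p \Po (q + r) = (p \Po q) + s * r.
Proof.
elim/poly_ind: p => [|p c [s IHp]]; first by exists 0; rewrite !comp_poly0; ring.
exists (s * (q + r) + (p \Po q)).
by rewrite !comp_poly_MXaddC IHp; ring.
Qed.

Definition eq_modX N p q := exists r, p = q + r * 'X^N.

Lemma eq_modXP N p q : eq_modX N p q <-> (forall n, (n < N)%N -> p`_n = q`_n).
Proof.
split=> [[r ->] n nN|pq]; first by rewrite coefD coefMXn nN addr0.
exists (drop_poly N (p - q)).
have /eqP : take_poly N (p - q) = 0.
  by apply/polyP=> i; rewrite coef_take_poly coef0 coefB; case: ltnP => // /pq ->; rewrite subrr.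
rewrite -[p in LHS](subrK q) -[p - q in LHS](poly_take_drop N) => /eqP ->.
by rewrite add0r addrC.
Qed.

(** The inner change yields a multiple of ['X^N] by [comp_polyD_dvd]; the outer change [r * 'X^N]
    becomes [(r o q) q ^ N], and ['X] divides [q]. *)
Lemma eq_modX_comp N p p' q q' : q`_0 = 0 ->
  eq_modX N p p' -> eq_modX N q q' -> eq_modX N (p \Po q) (p' \Po q').
Proof.
move=> q0 [r ->] [s qq'].
have [u uE] : exists u, q = u * 'X.
  exists (drop_poly 1 q); rewrite -[LHS](poly_take_drop 1) expr1.
  suff -> : take_poly 1 q = 0 by rewrite add0r.
  by apply/polyP => -[|i]; rewrite coef_take_poly coef0.
have [w wE] := comp_polyD_dvd p' q' (s * 'X^N).
exists (w * s + (r \Po q) * u ^+ N).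
rewrite comp_polyD comp_polyM comp_Xn_poly {1}qq' wE {2}uE exprMn; ring.
Qed.

Lemma eq_modX_trunc_comp N f g : g 0%N = 0 ->
  eq_modX N (trunc N (fps_comp f g)) (trunc N f \Po trunc N g).
Proof. by move=> g0; apply/eq_modXP => n nN; rewrite coef_trunc ?coef_comp_trunc. Qed.

Lemma trunc_coef0 N f : f 0%N = 0 -> (trunc N f)`_0 = 0.
Proof. by move=> f0; rewrite coef_poly f0 if_same. Qed.

Lemma fps_comp0 f g : fps_comp f g 0%N = f 0%N.
Proof. by rewrite /fps_comp big_ord1 mulr1. Qed.

(** Modulo ['X^(n+1)] both sides are composites of the three truncations, where [comp_polyA]
    applies. *)
Lemma fps_compA f g h : g 0%N = 0 -> h 0%N = 0 ->
  fps_comp (fps_comp f g) h = fps_comp f (fps_comp g h).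
Proof.
move=> g0 h0; apply/funext => n; have nN := ltnSn n.
have gh0 : fps_comp g h 0%N = 0 by rewrite fps_comp0.
rewrite -!(coef_comp_trunc _ _ nN) //.
have refl p : eq_modX n.+1 p p by apply/eq_modXP.
have /eq_modXP-> // := eq_modX_comp (trunc_coef0 n.+1 h0)
  (eq_modX_trunc_comp n.+1 f g0) (refl (trunc n.+1 h)).
rewrite -comp_polyA; apply/esym.
by have /eq_modXP-> // := eq_modX_comp (trunc_coef0 n.+1 gh0)
  (refl (trunc n.+1 f)) (eq_modX_trunc_comp n.+1 g h0).
Qed.

Lemma fps_exp1 f : fps_exp f 1 = f.
Proof.
apply/funext=> n; rewrite /= /fps_mul big_ord_recr /= subnn mulr1 big1 ?add0r //.
by move=> i _; rewrite /fps_Xn (_ : (n - i == 0)%N = false) ?mulr0 //; have := ltn_ord i; lia.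
Qed.

Lemma fps_exp_diag f k : f 0%N = 0 -> fps_exp f k k = f 1%N ^+ k.
Proof.
move=> f0; elim: k => [|k IHk]; first by rewrite expr0.
rewrite exprS -IHk /= /fps_mul !big_ord_recl f0 mul0r add0r /= /bump /= subn1 /=.
rewrite big1 ?addr0 // => i _.
by rewrite fps_exp_eq0 ?mulr0 //; have := ltn_ord i; lia.
Qed.

Lemma fps_exp_X k n : fps_exp (@fps_X A) k n = (n == k)%:R.
Proof.
rewrite -(@coef_exp_trunc n.+2) // (_ : trunc _ _ = 'X) ?coefXn //.
apply/polyP => i; rewrite coef_poly coefX /fps_X /fps_Xn.
by case: ltnP => //; case: eqP => // ->.
Qed.

Lemma fps_compX f : fps_comp f fps_X = f.
Proof.
apply/funext=> n; rewrite /fps_comp big_ord_recr /= fps_exp_X eqxx mulr1.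
rewrite big1 ?add0r // => i _.
by rewrite fps_exp_X (_ : (n == i) = false) ?mulr0 //; have := ltn_ord i; lia.
Qed.

Lemma fps_Xcomp f : f 0%N = 0 -> fps_comp fps_X f = f.
Proof.
move=> f0; apply/funext=> -[|n]; first by rewrite fps_comp0 f0.
rewrite /fps_comp !big_ord_recl /= /bump /= mul0r add0r.
rewrite -[fps_mul f _]/(fps_exp f 1) fps_exp1 /fps_X /fps_Xn eqxx mul1r.
by rewrite big1 ?addr0 // => i _; rewrite mul0r.
Qed.

Lemma fps_comp_coef1 f g : g 0%N = 0 -> fps_comp f g 1%N = f 1%N * g 1%N.
Proof.
move=> g0; rewrite /fps_comp !big_ord_recr big_ord0 /=.
by rewrite -[fps_mul g _]/(fps_exp g 1) fps_exp1 mulr0 !add0r.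
Qed.

Lemma tangent_to_id_comp f g :
  tangent_to_id f -> tangent_to_id g -> tangent_to_id (fps_comp f g).
Proof.
by move=> [f0 f1] [g0 g1]; split; rewrite ?fps_comp0 ?fps_comp_coef1 ?f1 ?g1 ?mulr1.
Qed.

Lemma tangent_to_id_inverse h hinv :
  tangent_to_id h -> fps_comp_inverse h hinv -> tangent_to_id hinv.
Proof.
move=> [h0 h1] [i0 hi _]; split=> //.
by have := congr1 (@^~ 1%N) hi; rewrite /= fps_comp_coef1 // h1 mul1r.
Qed.

(* The leading term of [f ^ j - g ^ j] is that of [j (f - g) x ^ (j - 1)]. *)
Lemma fps_exp_sub f g k : tangent_to_id f -> tangent_to_id g -> (1 < k)%N ->
    (forall i, (i < k)%N -> f i = g i) ->
  forall j n, (n < k + j)%N ->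
    fps_exp f j n - fps_exp g j n = (n.+1 == k + j)%N%:R * (j%:R * (f k - g k)).
Proof.
move=> [f0 f1] [g0 g1] k_gt1 fg; elim=> [|j IHj] n nkj.
  by rewrite subrr mul0r mulr0.
rewrite /= /fps_mul -sumrB.
case: n nkj => [|n] nkj.
  rewrite big_ord1 f0 g0 !mul0r subrr (_ : (1 == _)%N = false) ?mul0r //; lia.
rewrite 2!big_ord_recl /= f0 g0 !mul0r subrr add0r /bump /= subn1 /= f1 g1 !mul1r.
rewrite IHj; last by lia.
(* From index 2 on, the degree left for the [j]-th powers is too low for them to differ, by
   induction. *)
have E i : f (1 + (1 + i))%N * fps_exp f j (n.+1 - (1 + (1 + i)))%N -
           g (1 + (1 + i))%N * fps_exp g j (n.+1 - (1 + (1 + i)))%N =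
  (f (i.+2) - g i.+2) * fps_exp f j (n.+1 - i.+2)%N.
  rewrite !add1n.
  have /eqP : fps_exp f j (n.+1 - i.+2)%N - fps_exp g j (n.+1 - i.+2)%N = 0.
    rewrite IHj; last by lia.
    rewrite (_ : (_.+1 == _) = false) ?mul0r //; lia.
  by rewrite subr_eq0 => /eqP ->; ring.
under eq_bigr => i _ do rewrite E.
rewrite addnS eqSS.
have [nE|nE] := eqVneq n.+1 (k + j)%N; last first.
  rewrite !mul0r add0r big1 // => i _.
  have [ik|ki] := ltnP i.+2 k; first by rewrite fg ?subrr ?mul0r.
  by rewrite fps_exp_eq0 ?mulr0 //; have := ltn_ord i; lia.
(* Index [k] (that is [k - 2] after peeling off two terms) alone survives; it adds the one
   [f k - g k] that turns [j] into [j + 1]. *)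
have kn : (k - 2 < n)%N by lia.
rewrite (bigD1 (Ordinal kn)) //= (_ : (k - 2).+2 = k); last by lia.
rewrite big1 ?addr0 => [|i ik]; last first.
  have [{}ik|ki] := ltnP i.+2 k; first by rewrite fg ?subrr ?mul0r.
  have /eqP : (i != k - 2 :> nat)%N by apply: contra ik => /eqP iE; apply/eqP/val_inj.
  by move=> ?; rewrite fps_exp_eq0 ?mulr0 //; have := ltn_ord i; lia.
rewrite (_ : (n.+1 - k)%N = j); last by lia.
by rewrite fps_exp_diag // f1 expr1n -natr1; ring.
Qed.

(* Only the linear term of [v \o f] - [v \o g] could see [f n - g n]. *)
Lemma fps_comp_local v f g n : v 1%N = 0 -> f 0%N = 0 -> g 0%N = 0 ->
  (forall i, (i < n)%N -> f i = g i) -> fps_comp v f n = fps_comp v g n.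
Proof.
move=> v1 f0 g0 fg; apply: eq_bigr => -[[|[|k]] kn] _; rewrite ?v1 ?mul0r //.
congr (_ * _); rewrite /= in kn *.
have E j l : (l < n)%N -> fps_exp f j l = fps_exp g j l.
  elim: j l => // j IHj l ln; apply: eq_bigr => i _.
  by congr (_ * _); [apply: fg | apply: IHj]; have := ltn_ord i; lia.
apply: eq_bigr => i _.
change (f i * fps_exp f k.+1 (n - i)%N = g i * fps_exp g k.+1 (n - i)%N).
(* Both ends of the convolution vanish, by the zero constant terms; in between, [i] and [n - i] are
   both less than [n]. *)
have [->|i_gt0] := posnP i; first by rewrite f0 g0 !mul0r.
have [iE|iE] := eqVneq (nat_of_ord i) n.
  by rewrite iE subnn !fps_exp_eq0 ?mulr0.
by congr (_ * _); [apply: fg | apply: E]; have := ltn_ord i; lia.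
Qed.

End Truncation.

(** * Ring morphisms acting on coefficients *)

Section Morphism.
Variables (A B : comNzRingType) (phi : {rmorphism A -> B}).

Lemma fps_exp_morph (f : fps A) k n :
  phi (fps_exp f k n) = fps_exp (phi \o f) k n.
Proof.
elim: k n => [|k IHk] n /=; first by rewrite /fps_Xn rmorph_nat.
by rewrite rmorph_sum; apply: eq_bigr => i _; rewrite rmorphM IHk.
Qed.

Lemma fps_comp_morph (f g : fps A) n :
  phi (fps_comp f g n) = fps_comp (phi \o f) (phi \o g) n.
Proof.
by rewrite rmorph_sum; apply: eq_bigr => i _; rewrite rmorphM fps_exp_morph.
Qed.

End Morphism.

(** * Commuting series and formal flows in characteristic zero *)

Section FormalFlow.
Variable K : fieldType.
Hypothesis charK : [pchar K] =i pred0.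
Implicit Types (F g : fps K) (T : fps {poly K}).

Lemma natr_neq0 n : (0 < n)%N -> n%:R != 0 :> K.
Proof. by move=> n_gt0; rewrite ((pcharf0P K).1 charK) -lt0n. Qed.

Lemma natr_inj : injective (fun n => n%:R : K).
Proof.
move=> i j /= ij; wlog lt_ij : i j ij / (i < j)%N => [wl|].
  by case: (ltngtP i j) => // lt_ij; [apply: wl | apply/esym/wl].
have := @natr_neq0 (j - i)%N; rewrite subn_gt0 natrB ?ij ?subrr ?eqxx; last exact: ltnW.
by move=> /(_ lt_ij).
Qed.

(** Used from right to left, to spread one value over the sum defining a composition and compare
    term by term. *)
Lemma sum_delta (n a : nat) (c : K) : (a < n)%N ->
  \sum_(i < n) (i == a :> nat)%N%:R * c = c.
Proof.
move=> an; rewrite (bigD1 (Ordinal an)) //= eqxx mul1r big1 ?addr0 // => i ia.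
by rewrite (_ : (_ == _ :> nat) = false) ?mul0r //; apply: contraNF ia => /eqP ia; apply/eqP/val_inj.
Qed.

(* If [g1 - g2 = d x ^ k + ...], then at [x ^ (k + m - 1)] the difference of
   the two commutation relations reads [k d = m d]. *)
Lemma commuting_series_eq m F g1 g2 : (1 < m)%N ->
  tangent_to_id F -> (forall i, (1 < i < m)%N -> F i = 0) -> F m = 1 ->
  tangent_to_id g1 -> tangent_to_id g2 ->
  fps_comp g1 F = fps_comp F g1 -> fps_comp g2 F = fps_comp F g2 ->
  g1 m = g2 m -> g1 = g2.
Proof.
move=> m_gt1 tF F_low Fm t1 t2 c1 c2 gm; apply/funext => k.
elim/ltn_ind: k => k IHk.
have [k_le1|k_gt1] := leqP k 1.
  by case: k k_le1 {IHk} => [|[|]] // _; rewrite ?t1.1 ?t2.1 ?t1.2 ?t2.2.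
have [->//|km] := eqVneq k m.
set d := g1 k - g2 k.
have [n nE] : exists n, n.+1 = (k + m)%N by exists (k + m).-1; lia.
have tX : tangent_to_id (fps_X : fps K) by [].
have Xm : fps_X m = 0 :> K.
  by rewrite /fps_X /fps_Xn (_ : (m == 1)%N = false) //; lia.
have FX i : (i < m)%N -> F i = fps_X i.
  case: i => [|[|i]] im; rewrite ?tF.1 ?tF.2 //.
  by rewrite F_low // /fps_X.
(* Here [F ^ j = x ^ j + j x ^ (j + m - 1) + ...], so in degree [n] only [j = n] and [j = k]
   contribute. *)
have L : fps_comp g1 F n - fps_comp g2 F n = g1 n - g2 n + k%:R * d.
  rewrite /fps_comp -sumrB -[X in _ = X + _](@sum_delta n.+1 n) //.
  rewrite -[X in _ = _ + X](@sum_delta n.+1 k); last by lia.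
  rewrite -big_split /=; apply: eq_bigr => -[j jn] _ /=; rewrite -mulrBl.
  have [jk|kj] := ltnP j k.
    rewrite IHk // subrr mul0r (_ : (j == n)%N = false); last by lia.
    by rewrite (_ : (j == k)%N = false) ?mul0r ?addr0 //; lia.
  have /(canRL (subrK _)) -> : fps_exp F j n - fps_exp fps_X j n =
      (n.+1 == m + j)%N%:R * (j%:R * (F m - fps_X m)).
    by apply: fps_exp_sub => //; lia.
  rewrite fps_exp_X Fm Xm subr0 mulr1 mulrDr addrC (eq_sym j n).
  congr (_ + _); last first.
    by case: eqP => [->|_]; rewrite ?mulr1 ?mul1r ?mulr0 ?mul0r.
  rewrite (_ : (n.+1 == m + j)%N = (j == k)%N); last by lia.
  by case: eqP => [->|_]; rewrite ?mul1r ?mulr0 ?mul0r ?mulr0 // mulrC.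
(* Below [m] only [j = 1] has [F j != 0]; from [m] on, [g1 ^ j - g2 ^ j] starts in degree
   [k + j - 1], which is [n] only for [j = m]. *)
have Rr : fps_comp F g1 n - fps_comp F g2 n = g1 n - g2 n + m%:R * d.
  rewrite /fps_comp -sumrB -[X in _ = X + _](@sum_delta n.+1 1); last by lia.
  rewrite -[X in _ = _ + X](@sum_delta n.+1 m); last by lia.
  rewrite -big_split /=; apply: eq_bigr => -[j jn] _ /=; rewrite -mulrBr.
  have [jm|mj] := ltnP j m.
    rewrite [X in _ = _ + X * _](_ : _ = 0) ?mul0r ?addr0; last first.
      by rewrite (_ : (j == m)%N = false) //; lia.
    rewrite FX // /fps_X /fps_Xn; case: eqP => [->|_]; last by rewrite !mul0r.
    by rewrite !fps_exp1.
  rewrite (_ : (j == 1)%N = false) ?mul0r ?add0r; last by lia.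
  rewrite (@fps_exp_sub _ g1 g2 k) //; last by lia.
  rewrite nE eqn_add2l (eq_sym m).
  by case: eqP => [->|_]; rewrite ?mul0r ?mulr0 // !mul1r Fm mul1r.
have /eqP : k%:R * d = m%:R * d.
  by apply: (addrI (g1 n - g2 n)); rewrite -L -Rr c1 c2.
rewrite -subr_eq0 -mulrBl mulf_eq0 !subr_eq0 => /orP[/eqP/natr_inj kmE|/eqP //].
by rewrite kmE eqxx in km.
Qed.

Lemma poly_deriv_inj (p q : {poly K}) : p^`() = q^`() -> p.[0] = q.[0] -> p = q.
Proof.
move=> pq; rewrite !horner_coef0 => pq0; apply/polyP => -[//|i].
have /eqP := congr1 (fun r : {poly K} => r`_i) pq.
rewrite !coef_deriv -subr_eq0 -mulrnBl -mulr_natr mulf_eq0.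
by rewrite (negPf (natr_neq0 _)) // orbF subr_eq0 => /eqP.
Qed.

(** By [fps_comp_local], the derivative of the [n]-th coefficient depends only on earlier ones; with
    the value at 0 it determines that coefficient. *)
Lemma flow_ode_unique (w : fps {poly K}) (U W : fps {poly K}) :
  w 1%N = 0 -> U 0%N = 0 -> W 0%N = 0 ->
  (forall n, (U n)^`() = fps_comp w U n) ->
  (forall n, (W n)^`() = fps_comp w W n) ->
  (forall n, (U n).[0] = (W n).[0]) -> U = W.
Proof.
move=> w1 U0 W0 dU dW UW0; apply/funext => n.
elim/ltn_ind: n => n IHn; apply: poly_deriv_inj => //.
by rewrite dU dW; apply: fps_comp_local.
Qed.

Lemma flow_at0 v T t : is_flow v T -> flow_at T t 0%N = 0.
Proof. by move=> [T0 _ _]; rewrite /flow_at T0 horner0. Qed.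

Lemma flow_atD v T s t : v 1%N = 0 -> is_flow v T ->
  fps_comp (flow_at T s) (flow_at T t) = flow_at T (s + t).
Proof.
move=> v1 flT; have [T0 dT initT] := flT.
(* For fixed [t], with ['X] in the role of [s]: [fps_comp T G] is [T^s o T^t] and [W] is [T^(s+t)].
   Both solve the flow equation in [s] with value [T^t] at 0. *)
pose G : fps {poly K} := polyC \o flow_at T t.
pose W : fps {poly K} := fun n => T n \Po ('X + t%:P).
have G0 : G 0%N = 0 by rewrite /G /= (flow_at0 t flT).
have horn x U V n : (fps_comp U V n : {poly K}).[x] =
    fps_comp (fun i => (U i).[x]) (fun i => (V i).[x]) n.
  exact: (fps_comp_morph (horner_eval x)).
have UE : fps_comp T G = W.
  apply: (@flow_ode_unique (fun k => (v k)%:P)).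
  - by rewrite v1.
  - by rewrite fps_comp0.
  - by rewrite /W T0 comp_poly0.
  - move=> n; rewrite -fps_compA // -(funext dT) /fps_comp raddf_sum.
    by apply: eq_bigr => i _ /=; rewrite -fps_exp_morph derivM derivC mulr0 addr0.
  - move=> n; rewrite /W deriv_comp derivD derivX derivC addr0 mulr1 dT.
    rewrite (fps_comp_morph (comp_poly ('X + t%:P))).
    by congr (fps_comp _ _ n); apply/funext => k /=; rewrite comp_polyC.
  - move=> n; rewrite horn /W horner_comp hornerD hornerX hornerC add0r.
    have -> : (fun i => (T i).[0]) = fps_X by apply/funext.
    rewrite fps_Xcomp /G /= ?hornerC ?(flow_at0 t flT) //.
apply/funext => n; have := congr1 (fun U : fps {poly K} => (U n).[s]) UE.
rewrite horn /W horner_comp hornerD hornerX hornerC => UWn.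
rewrite [RHS]/flow_at -UWn.
by congr (fps_comp _ _ n); apply/funext => k; rewrite /G /= hornerC.
Qed.

(** The series [v o T] starts in degree [m], so lower coefficients of [T] are constant in [t]. *)
Lemma flow_coef_lt v T m n : is_flow v T -> (forall i, (i < m)%N -> v i = 0) ->
  (n < m)%N -> T n = (fps_X n)%:P.
Proof.
move=> [T0 dT initT] v_low nm; apply: poly_deriv_inj; last by rewrite initT hornerC.
rewrite dT derivC /fps_comp big1 // => i _.
by rewrite v_low ?mul0r //; have := ltn_ord i; lia.
Qed.

Lemma flow_coef_eq v T m : (1 < m)%N -> is_flow v T ->
  (forall i, (i < m)%N -> v i = 0) -> v m = 1 -> T m = 'X.
Proof.
move=> m_gt1 flT v_low vm; have [T0 dT initT] := flT.
apply: poly_deriv_inj.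
  rewrite dT derivX /fps_comp big_ord_recr /= big1 => [|i _].
    by rewrite fps_exp_diag // (flow_coef_lt flT v_low) // vm !expr1n mulr1 add0r.
  by rewrite v_low ?mul0r.
rewrite initT hornerX /fps_X /fps_Xn (_ : (m == 1)%N = false) //; lia.
Qed.

End FormalFlow.

(** * Geometric decay and ultrametric bounds on coefficients *)

Lemma exists_expr_lt (R : realType) (a e : R) :
  0 <= a -> a < 1 -> 0 < e -> exists n, a ^+ n < e.
Proof.
rewrite le_eqVlt => /predU1P[<- _ e0|a_gt0 a_lt1 e_gt0].
  by exists 1%N; rewrite expr1.
set b := a^-1; have b_gt1 : 1 < b by rewrite invf_gt1.
have bernoulli n : 1 + n%:R * (b - 1) <= b ^+ n.
  elim: n => [|n IHn]; first by rewrite mul0r addr0 expr0.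
  rewrite exprS -natr1; apply: le_trans (ler_wpM2l (ltW (lt_trans ltr01 b_gt1)) IHn).
  by have := mulr_ge0 (ler0n R n) (sqr_ge0 (b - 1)); rewrite expr2; lra.
(* By Bernoulli, [b ^+ n > e^-1] once [n] exceeds this value. *)
pose c := e^-1 / (b - 1).
have c_ge0 : 0 <= c by rewrite divr_ge0 ?invr_ge0 ?subr_ge0 // ltW.
exists (Num.bound c); have := archi_boundP c_ge0; have := bernoulli (Num.bound c).
set n := Num.bound c => bn cn.
rewrite -[a]invrK -/b exprVn -[e]invrK ltf_pV2 ?posrE ?invr_gt0 ?exprn_gt0 ?invr_gt0 //.
move: cn; rewrite /c ltr_pdivrMr ?subr_gt0 // => cn; lra.
Qed.

(* [le x b] reads "the norm of x is at most b", for an ultrametric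
   submultiplicative norm whose value need not be a real number itself. *)
Record ultra_bound (A : comNzRingType) (R : realType) (le : A -> R -> Prop) : Prop :=
  UltraBound {
    ub0 : forall b, 0 <= b -> le 0 b;
    ub1 : le 1 1;
    ubD : forall x y b, le x b -> le y b -> le (x + y) b;
    ubM : forall x y b c, 0 <= b -> 0 <= c -> le x b -> le y c -> le (x * y) (b * c)
  }.

Section UltraBound.
Variables (A : comNzRingType) (R : realType) (le : A -> R -> Prop).
Hypothesis leP : ultra_bound le.
Implicit Types (f g : fps A).

Lemma ub_sum n (F : 'I_n -> A) b : 0 <= b -> (forall i, le (F i) b) ->
  le (\sum_i F i) b.
Proof. by move=> b0 Fb; elim/big_ind: _ => // [|x y]; [exact: ub0 | exact: ubD]. Qed.

(** With the exponent of [B] one less than the degree, a product of [k] factors in degree [n] costs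
    exactly [B ^+ (n - k)]. The cutoff [N] allows use inside an induction where only the first
    coefficients are bounded yet. *)
Lemma fps_exp_bound B N f : 0 <= B -> f 0%N = 0 ->
  (forall j, (j < N)%N -> le (f j.+1) (B ^+ j)) ->
  forall k n, (k <= n)%N -> (n - k < N)%N -> le (fps_exp f k n) (B ^+ (n - k)).
Proof.
move=> B0 f0 fB; elim=> [|k IHk] n kn nkN.
  by case: n {kn nkN} => [|n]; [exact: ub1 | apply: ub0 => //; exact: exprn_ge0].
apply: ub_sum => [|i]; first exact: exprn_ge0.
change (le (f i * fps_exp f k (n - i)%N) (B ^+ (n - k.+1))).
have [->|i_gt0] := posnP i; first by rewrite f0 mul0r; apply: ub0 => //; exact: exprn_ge0.
have [nik|kni] := ltnP (n - i) k.
  by rewrite fps_exp_eq0 // mulr0; apply: ub0 => //; exact: exprn_ge0.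
have -> : (n - k.+1)%N = (i.-1 + (n - i - k))%N by have := ltn_ord i; lia.
rewrite exprD; apply: ubM; rewrite ?exprn_ge0 //; last by apply: IHk; have := ltn_ord i; lia.
by rewrite -{1}(prednK i_gt0); apply: fB; have := ltn_ord i; lia.
Qed.

(** The coefficient of [f] costs [B ^+ k] and the power of [g] costs [B ^+ (n - k)], so every term
    has the same bound [B ^+ n]. *)
Lemma fps_comp_bound B f g : 0 <= B -> g 0%N = 0 ->
  (forall n, le (f n.+1) (B ^+ n)) -> (forall n, le (g n.+1) (B ^+ n)) ->
  forall n, le (fps_comp f g n.+1) (B ^+ n).
Proof.
move=> B0 g0 fB gB n; apply: ub_sum => [|[[|k] kn] /=]; first exact: exprn_ge0.
  by rewrite mulr0; apply: ub0 => //; exact: exprn_ge0.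
have -> : B ^+ n = B ^+ k * B ^+ (n.+1 - k.+1) by rewrite -exprD; congr (_ ^+ _); lia.
apply: ubM; rewrite ?exprn_ge0 //.
by apply: (@fps_exp_bound B n.+2 g B0 g0 _ k.+1 n.+1) => //; lia.
Qed.

End UltraBound.

(** * Convergence and coefficient growth over a non-archimedean field *)

Section AbsoluteValue.
Variables (K : fieldType) (R : realType) (abs : K -> R).
Hypothesis absP : nonarch_absval abs.
Implicit Types (f g h : fps K).

Let abs_ge0 x : 0 <= abs x. Proof. exact: absval_ge0 absP x. Qed.
Let absM x y : abs (x * y) = abs x * abs y. Proof. exact: absvalM absP x y. Qed.
Let abs0 : abs 0 = 0. Proof. exact/(absval_eq0 absP). Qed.
Let abs_gt0 x : x != 0 -> 0 < abs x.
Proof.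
by move=> x0; rewrite lt_neqAle abs_ge0 andbT eq_sym; apply: contra x0 => /eqP/(absval_eq0 absP) ->.
Qed.
Let abs1 : abs 1 = 1.
Proof.
have a1 := abs_gt0 (oner_neq0 K).
by apply: (mulfI (lt0r_neq0 a1)); rewrite -absM !mulr1.
Qed.
Let absX x n : abs (x ^+ n) = abs x ^+ n.
Proof. by elim: n => [|n IHn]; rewrite ?expr0 // !exprS absM IHn. Qed.
Let absN x : abs (- x) = abs x.
Proof.
have absN1 : abs (- 1) = 1.
  by apply/eqP; rewrite -(@eqrXn2 _ 2) // -absX sqrrN !expr1n abs1.
by rewrite -mulN1r absM absN1 mul1r.
Qed.

Lemma absval_ultra_bound : ultra_bound (fun x b => abs x <= b).
Proof.
split=> [b|||x y b c b0 c0 xb yc]; rewrite ?abs0 ?abs1 //.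
  by move=> x y b xb yb; apply: le_trans (absvalD absP x y) _; rewrite ge_max xb.
by rewrite absM ler_pM.
Qed.
Let ubP := absval_ultra_bound.

Lemma absval_nat_le1 n : abs n%:R <= 1.
Proof. by elim: n => [|n IHn]; [rewrite abs0 | rewrite -natr1; apply: (ubD ubP) => //; rewrite abs1]. Qed.

Lemma absval_addl x y : abs x < abs y -> abs (x + y) = abs y.
Proof.
move=> xy; apply/eqP; rewrite eq_le (ubD ubP) ?(ltW xy) //=.
rewrite leNgt; apply/negP => xyy.
have : abs (- x + (x + y)) <= Num.max (abs (- x)) (abs (x + y)) by exact: absvalD.
by rewrite addKr absN leNgt gt_max xy xyy.
Qed.

(* If [p] is the least positive integer with [|p| < 1], then
   [|n!| = |p| ^ (n / p) |(n / p)!|]. *)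
Lemma absval_fact_ge (charK : [pchar K] =i pred0) :
  exists c : R, [/\ 0 < c, c <= 1 & forall n, c ^+ n <= abs (n`!)%:R].
Proof.
have natK n : (0 < n)%N -> 0 < abs n%:R by move=> n0; apply/abs_gt0/natr_neq0.
have [ex_p|unit_nat] := pselect (exists p, (0 < p)%N && (abs p%:R < 1)); last first.
  exists 1; split=> // n; rewrite expr1n; elim: n => [|n IHn]; first by rewrite abs1.
  rewrite factS natrM absM; apply: mulr_ege1 => //.
  by rewrite leNgt; apply/negP => n1; apply: unit_nat; exists n.+1.
case: (ex_minnP ex_p) => p /andP[p_gt0 p_lt1] p_min.
set a := abs p%:R in p_lt1 *; have a_gt0 : 0 < a := natK _ p_gt0.
have p_gt1 : (1 < p)%N.
  by case: p p_gt0 @a p_lt1 {p_min a_gt0} => [|[|p]] //= _; rewrite abs1 ltxx.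
have small r : (0 < r < p)%N -> abs r%:R = 1.
  move=> /andP[r_gt0 rp]; apply/eqP; rewrite eq_le absval_nat_le1 leNgt.
  apply/negP => r1; have := p_min r; rewrite r_gt0 r1 leqNgt rp => /(_ isT) //.
have abs_coprime n : ~~ (p %| n)%N -> abs n%:R = 1.
  move=> pn; rewrite {1}(divn_eq n p) natrD.
  have r1 : abs (n %% p)%:R = 1.
    by apply: small; rewrite ltn_mod p_gt0 lt0n -/(dvdn p n) pn.
  rewrite absval_addl r1 // natrM absM -/a.
  by apply: le_lt_trans p_lt1; rewrite ler_piMl ?absval_nat_le1 // ltW.
have factE n : abs (n`!)%:R = a ^+ (n %/ p) * abs ((n %/ p)`!)%:R.
  elim: n => [|n IHn]; first by rewrite div0n mul1r.
  rewrite factS natrM absM IHn divnS //.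
  have [pn|pn] := boolP (p %| n.+1)%N; last by rewrite abs_coprime // mul1r.
  rewrite add1n factS natrM absM exprS -{1}(divnK pn) natrM absM -/a divnS // pn add1n.
  by ring.
(* [factE] and the induction hypothesis each give the exponent [n %/ p]; their sum is at most [n]
   because [p >= 2]. *)
exists a; split=> //; first exact: ltW.
elim/ltn_ind=> n IHn; have [->|n_gt0] := posnP n; first by rewrite abs1.
have np : (n %/ p < n)%N by rewrite ltn_Pdiv.
rewrite factE; apply: le_trans (ler_wpM2l _ (IHn _ np)); last by rewrite exprn_ge0 ?ltW.
rewrite -exprD; apply: ler_wiXn2l; rewrite ?ltW ?(ltW p_lt1) //.
have := leq_trunc_div n p; nia.
Qed.

Definition geom_bounded f := exists2 B : R, 1 <= B & forall n, abs (f n.+1) <= B ^+ n.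

(** At a small [z != 0] the terms of the convergent series are differences of partial sums, hence
    bounded by some [C]; this gives [|f_n| <= C |z|^(-n)]. *)
Lemma analytic_geom_bounded f : nontrivial_absval abs -> analytic abs f ->
  tangent_to_id f -> geom_bounded f.
Proof.
move=> [x x0 x1] [r r_gt0 f_cvg] [f0 f1].
have [z [z0 z1 zr]] : exists z, [/\ z != 0, abs z < 1 & abs z < r].
  have [y [y0 y1]] : exists y, y != 0 /\ abs y < 1.
    case: (ltgtP (abs x) 1) x1 => // xlt _; first by exists x.
    exists x^-1; rewrite invr_eq0; split=> //.
    have := congr1 abs (mulfV x0); rewrite absM abs1 => xV.
    by have := abs_ge0 x^-1; nra.
  have [n yn] := exists_expr_lt (abs_ge0 y) y1 r_gt0.
  exists (y ^+ n.+1); rewrite expf_eq0 (negPf y0) andbF absX exprS; split=> //.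
    by rewrite -exprS exprn_ilt1.
  by apply: le_lt_trans yn; rewrite ler_piMl ?exprn_ge0 // ltW.
have z_gt0 := abs_gt0 z0.
have [l cvg_l] := f_cvg z zr; have [N NP] := cvg_l 1 ltr01.
have tail n : (N <= n)%N -> abs (f n * z ^+ n) <= 1.
  move=> Nn; have := NP n.+1 (leqW Nn); have := NP n Nn; rewrite big_ord_recr /=.
  set S := \sum_(_ < _) _ => Sn Sn1.
  rewrite (_ : f n * z ^+ n = (S + f n * z ^+ n - l) + - (S - l)); last by ring.
  by apply: (ubD ubP); rewrite ?absN ltW.
have [C C1 CP] : exists2 C : R, 1 <= C & forall n, abs (f n * z ^+ n) <= C.
  exists (1 + \sum_(i < N) abs (f i * z ^+ i)); first by rewrite lerDl sumr_ge0.
  move=> n; have [nN|Nn] := ltnP n N.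
    rewrite (bigD1 (Ordinal nN)) //= addrCA lerDl addr_ge0 // sumr_ge0 //.
  by apply: le_trans (tail n Nn) _; rewrite lerDl sumr_ge0.
set w := (abs z)^-1; have w1 : 1 <= w by rewrite invf_ge1 // ltW.
(* Degree [n + 2] has exponent [n + 1], and [n + 2 <= 2 (n + 1)]; degree 1 leaves no room for [C]
   and is settled by [f 1 = 1]. *)
exists (C * w ^+ 2); first by rewrite mulr_ege1 // exprn_ege1.
case=> [|n]; first by rewrite f1 abs1 expr0.
apply: (@le_trans _ _ (C * w ^+ n.+2)).
  by have := CP n.+2; rewrite absM absX /w exprVn ler_pdivlMr ?exprn_gt0.
rewrite exprMn -exprM; apply: ler_pM; rewrite ?(le_trans ler01) ?exprn_ege1 //.
  by rewrite exprS ler_peMr ?(le_trans ler01) ?exprn_ege1.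
by apply: ler_weXn2l => //; lia.
Qed.

(** A block of terms is no larger than its largest term, so terms of size at most [(B |z|) ^ n] make
    the partial sums Cauchy. *)
Lemma geom_bounded_analytic f : absval_complete abs -> geom_bounded f -> analytic abs f.
Proof.
move=> complete [B B1 fB]; have B_gt0 : 0 < B := lt_le_trans ltr01 B1.
exists B^-1; rewrite ?invr_gt0 // => z zB; apply: complete => e e_gt0.
set a := B * abs z; have a0 : 0 <= a by rewrite mulr_ge0 // ltW.
have a1 : a < 1 by rewrite /a mulrC -ltr_pdivlMr // mul1r.
have term n : abs (f n.+1 * z ^+ n.+1) <= a ^+ n.+1.
  rewrite absM absX exprMn ler_wpM2r ?exprn_ge0 //.
  by apply: le_trans (fB n) _; rewrite exprS ler_peMl ?exprn_ge0 // ltW.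
have [N aN] := exists_expr_lt a0 a1 e_gt0.
have tail i d : (N < i)%N ->
  abs (\sum_(n < i + d) f n * z ^+ n - \sum_(n < i) f n * z ^+ n) <= a ^+ N.
  move=> Ni; rewrite big_split_ord /= [X in abs X]addrC addKr.
  apply: (ub_sum ubP) => [|n]; first exact: exprn_ge0.
  rewrite -[(i + n)%N]prednK; last by lia.
  by apply: le_trans (term _) _; apply: ler_wiXn2l; rewrite ?(ltW a1) //; lia.
(* Starting at [N.+1] keeps out the constant coefficient, which [geom_bounded] does not control. *)
exists N.+1 => i j Ni Nj; apply: le_lt_trans aN.
have [ij|/ltnW ji] := leqP i j.
  by rewrite -absN opprB -(subnKC ij); exact: tail.
by rewrite -(subnKC ji); exact: tail.
Qed.

Lemma comp_geom_bounded f g : g 0%N = 0 ->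
  geom_bounded f -> geom_bounded g -> geom_bounded (fps_comp f g).
Proof.
move=> g0 [B B1 fB] [C C1 gC]; exists (Num.max B C); first by rewrite le_max B1.
apply: (fps_comp_bound ubP) => //.
- by rewrite le_max (le_trans ler01 B1).
- move=> n; apply: le_trans (fB n) _.
  by rewrite lerXn2r ?nnegrE ?le_max ?lexx ?(le_trans ler01 B1).
- move=> n; apply: le_trans (gC n) _.
  by rewrite lerXn2r ?nnegrE ?le_max ?lexx ?(le_trans ler01 C1) ?orbT.
Qed.

(** As [h ^ (n+1)] has leading coefficient 1, [hinv o h = x] expresses [hinv (n+1)] through earlier
    coefficients times powers of [h]. *)
Lemma inverse_geom_bounded h hinv : tangent_to_id h -> fps_comp_inverse h hinv ->
  geom_bounded h -> geom_bounded hinv.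
Proof.
move=> [h0 h1] [i0 _ ih] [B B1 hB]; have B0 : 0 <= B := le_trans ler01 B1.
exists B => //; elim/ltn_ind=> n IHn.
have : fps_comp hinv h n.+1 = fps_X n.+1 by rewrite ih.
rewrite /fps_comp big_ord_recr (fps_exp_diag _ h0) h1 expr1n mulr1.
move=> /(canRL (addKr _)) ->.
apply: (ubD ubP).
  rewrite absN; apply: (ub_sum ubP) => [|[[|k] kn] /=]; first exact: exprn_ge0.
    by rewrite i0 mul0r abs0 exprn_ge0.
  have -> : B ^+ n = B ^+ k * B ^+ (n.+1 - k.+1) by rewrite -exprD; congr (_ ^+ _); lia.
  apply: (ubM ubP); rewrite ?exprn_ge0 ?IHn //.
  by apply: (@fps_exp_bound _ _ _ ubP B n.+2 h B0 h0 _ k.+1 n.+1) => //; lia.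
rewrite /fps_X /fps_Xn; case: n {IHn} => [|n]; first by rewrite abs1 expr0.
by rewrite abs0 exprn_ge0.
Qed.

(* The factorials make this norm submultiplicative (Leibniz) and integration
   in t bounded by rho. *)
Definition divided_power_le (rho : R) (p : {poly K}) (b : R) :=
  forall k, abs (p`_k * (k`!)%:R) * rho ^+ k <= b.

Lemma divided_power_ultra_bound rho : 0 < rho -> ultra_bound (divided_power_le rho).
Proof.
move=> rho_gt0; have rX k : 0 < rho ^+ k by exact: exprn_gt0.
split=> [b b0 k|[|k]|x y b xb yb k|x y b c b0 c0 xb yc k].
- by rewrite coef0 mul0r abs0 mul0r.
- by rewrite coef1 mul1r abs1 mul1r.
- by rewrite coef1 mul0r abs0 mul0r.
- have := xb k; have := yb k; rewrite coefD mulrDl -!ler_pdivlMr //.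
  by move=> ? ?; apply: (ubD ubP).
- rewrite -ler_pdivlMr // coefM mulr_suml; apply: (ub_sum ubP) => [|i].
    by rewrite divr_ge0 ?mulr_ge0 // ltW.
  have ik : (i <= k)%N by rewrite -ltnS.
  (* The weight [k!] splits between the factors up to a binomial coefficient, an integer and so of
     absolute value at most 1. *)
  rewrite -(bin_fact ik) !natrM.
  rewrite (_ : _ * _ = 'C(k, i)%:R * ((x`_i * (i`!)%:R) * (y`_(k - i) * ((k - i)`!)%:R))); last by ring.
  rewrite absM; apply: le_trans (_ : 1 * _ <= _); first exact: ler_wpM2r (absval_nat_le1 _).
  rewrite mul1r absM ler_pdivlMr //.
  have -> : rho ^+ k = rho ^+ i * rho ^+ (k - i) by rewrite -exprD subnKC.
  rewrite mulrACA.
  by apply: ler_pM => //; apply: mulr_ge0 => //; exact: exprn_ge0 (ltW rho_gt0).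
Qed.

(** Here [|t|^i <= c^i rho^i <= |i!| rho^i], so each monomial at [t] is at most its weighted
    coefficient. *)
Lemma divided_power_horner rho c t p b : 0 <= b ->
  (forall n, c ^+ n <= abs (n`!)%:R) -> 0 < c -> abs t <= c * rho ->
  divided_power_le rho p b -> abs p.[t] <= b.
Proof.
move=> b0 cP c0 tc pb; rewrite horner_coef; apply: (ub_sum ubP) => // i.
apply: le_trans (pb i); rewrite !absM absX -mulrA ler_wpM2l //.
apply: (@le_trans _ _ ((c * rho) ^+ i)).
  by rewrite lerXn2r ?nnegrE // (le_trans _ tc).
rewrite exprMn ler_wpM2r // exprn_ge0 //.
by have := le_trans (abs_ge0 t) tc; rewrite pmulr_rge0.
Qed.

(** Since [v] starts in degree 2, the derivative of [T (n+1)] involves only earlier coefficients and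
    is bounded by [rho^-1 * B ^+ n]; integration gives the [rho] back. *)
Lemma flow_bound v T rho B : 0 < rho -> 1 <= B ->
  v 0%N = 0 -> v 1%N = 0 -> (forall n, rho * abs (v n.+1) <= B ^+ n) ->
  is_flow v T -> forall n, divided_power_le rho (T n.+1) (B ^+ n).
Proof.
move=> rho_gt0 B1 v0 v1 vB [T0 dT initT]; have B0 : 0 <= B := le_trans ler01 B1.
have lP := divided_power_ultra_bound rho_gt0.
elim/ltn_ind=> n IHn [|k].
  rewrite mulr1 -horner_coef0 initT mulr1 /fps_X /fps_Xn.
  by case: n {IHn} => [|n]; rewrite ?abs1 ?abs0 ?expr0 ?exprn_ge0.
have dTn : divided_power_le rho (T n.+1)^`() (rho^-1 * B ^+ n).
  rewrite dT; apply: (ub_sum lP) => [|[[|[|i]] iN] /=].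
  - by rewrite mulr_ge0 ?exprn_ge0 ?invr_ge0 // ltW.
  - by rewrite v0 mul0r; apply: (ub0 lP); rewrite mulr_ge0 ?exprn_ge0 ?invr_ge0 // ltW.
  - by rewrite v1 mul0r; apply: (ub0 lP); rewrite mulr_ge0 ?exprn_ge0 ?invr_ge0 // ltW.
  have -> : B ^+ n = B ^+ i.+1 * B ^+ (n.+1 - i.+2) by rewrite -exprD; congr (_ ^+ _); lia.
  rewrite mulrA; apply: (ubM lP); rewrite ?mulr_ge0 ?exprn_ge0 ?invr_ge0 ?(ltW rho_gt0) //.
    case=> [|k']; last by rewrite coefC mul0r abs0 mul0r mulr_ge0 ?exprn_ge0 ?invr_ge0 // ltW.
    by rewrite coefC eqxx !mulr1 mulrC ler_pdivlMr // mulrC.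
  by apply: (@fps_exp_bound _ _ _ lP B n T B0 T0 _ i.+2 n.+1) => //; lia.
have := dTn k; rewrite coef_deriv -[_`__ *+ _]mulr_natr -mulrA -natrM -factS.
by rewrite mulrC ler_pdivlMl // mulrA -exprS mulrC.
Qed.

(** Each use of the recurrence raises the degree by [m - 1 >= 1], which pays for [|c|]; the exponent
    [m - 1] in degree [m] pays for [rho]. *)
Lemma vector_field_bound m c v rho B : (1 < m)%N -> 1 <= B -> 0 <= rho -> rho <= B ->
  abs c <= B -> (forall n, (n < m)%N -> v n = 0) -> v m = 1 ->
  (forall n, (m < n)%N -> v n = c * v (n - m.-1)%N) ->
  forall n, rho * abs (v n.+1) <= B ^+ n.
Proof.
move=> m_gt1 B1 rho0 rhoB cB v_low vm v_rec; have B0 : 0 <= B := le_trans ler01 B1.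
elim/ltn_ind=> n IHn; case: (ltngtP n.+1 m) => [nm|mn|nm].
- by rewrite v_low // abs0 mulr0 exprn_ge0.
- rewrite v_rec // absM mulrCA.
  have E : (n.+1 - m.-1)%N = (n - m.-1).+1 by lia.
  apply: (@le_trans _ _ (B * B ^+ (n - m.-1))).
    by rewrite E; apply: ler_pM; rewrite ?mulr_ge0 ?IHn //; lia.
  by rewrite -exprS; apply: ler_weXn2l => //; lia.
- rewrite nm vm abs1 mulr1; apply: le_trans rhoB _.
  by rewrite -{1}[B]expr1; apply: ler_weXn2l => //; lia.
Qed.

Lemma flow_geom_bounded m c v T t : [pchar K] =i pred0 -> (1 < m)%N ->
  (forall n, (n < m)%N -> v n = 0) -> v m = 1 ->
  (forall n, (m < n)%N -> v n = c * v (n - m.-1)%N) ->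
  is_flow v T -> geom_bounded (flow_at T t).
Proof.
move=> charK m_gt1 v_low vm v_rec flT.
have [a [a0 _ aP]] := absval_fact_ge charK.
(* This gives [|t| <= a * rho], and the [1 +] keeps [rho] positive at [t = 0]. *)
pose rho := (1 + abs t) / a; have rho_gt0 : 0 < rho by rewrite divr_gt0 // ltr_pwDl.
pose B := 1 + rho + abs c.
have [B1 rhoB cB] : [/\ 1 <= B, rho <= B & abs c <= B].
  by rewrite /B; have := abs_ge0 c; split; lra.
exists B => // n; apply: (divided_power_horner _ aP a0 (rho := rho)).
- by rewrite exprn_ge0 // (le_trans ler01).
- by rewrite /rho mulrC divfK ?gt_eqF // lerDr.
apply: (flow_bound rho_gt0 B1 _ _ _ flT); rewrite ?v_low //; first exact: ltnW.
exact: (vector_field_bound m_gt1 B1 (ltW rho_gt0) rhoB cB).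
Qed.

End AbsoluteValue.

(** * Recurrence for the vector field, and conjugation by [h] *)

Lemma vector_field_coef (K : fieldType) (m : nat) (c : K) (v : fps K) : (1 < m)%N ->
  fps_mul v (fun n => fps_Xn K 0 n - c * fps_Xn K (m - 1) n) = fps_Xn K m ->
  forall n, v n = fps_Xn K m n + (if (n < m.-1)%N then 0 else c * v (n - m.-1)%N).
Proof.
move=> m_gt1 vE n; have <- := congr1 (@^~ n) vE.
rewrite /fps_mul /= -[LHS]mulr1; under eq_bigr => i _ do rewrite mulrBr.
rewrite sumrB big_ord_recr /= subnn big1 ?add0r => [|i _]; last first.
  by rewrite /fps_Xn (_ : (n - i == 0)%N = false) ?mulr0 //; have := ltn_ord i; lia.
rewrite -addrA [X in _ + X](_ : _ = 0) ?addr0 //; apply/eqP; rewrite addrC subr_eq0; apply/eqP.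
have [nm|mn] := ltnP n m.-1.
  by rewrite big1 // => i _; rewrite /fps_Xn (_ : (_ == _)%N = false) ?mulr0 //; lia.
have nmn : (n - m.-1 < n.+1)%N by lia.
rewrite (bigD1 (Ordinal nmn)) //= big1 ?addr0 => [|i ni].
  by rewrite /fps_Xn (_ : (_ == _)%N = true) ?mulr1 1?mulrC //; lia.
have /eqP : (i != n - m.-1 :> nat)%N by apply: contra ni => /eqP iE; apply/eqP/val_inj.
by move=> iE; rewrite /fps_Xn (_ : (_ == _)%N = false) ?mulr0 ?mulr0 //; have := ltn_ord i; lia.
Qed.

(** Conjugation respects composition, as the inner [hinv o h] cancels. *)
Lemma conjugate_comm (A : comNzRingType) (h hinv f g : fps A) :
  tangent_to_id h -> fps_comp_inverse h hinv -> f 0%N = 0 -> g 0%N = 0 ->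
  fps_comp g f = fps_comp f g ->
  fps_comp (fps_comp h (fps_comp g hinv)) (fps_comp h (fps_comp f hinv)) =
  fps_comp (fps_comp h (fps_comp f hinv)) (fps_comp h (fps_comp g hinv)).
Proof.
move=> [h0 _] [i0 _ ih] f0 g0 gf.
have conj_comp (a b : fps A) : a 0%N = 0 -> b 0%N = 0 ->
    fps_comp (fps_comp h (fps_comp a hinv)) (fps_comp h (fps_comp b hinv)) =
    fps_comp h (fps_comp (fps_comp a b) hinv).
  move=> a0 b0; have bi0 : fps_comp b hinv 0%N = 0 by rewrite fps_comp0.
  have hbi0 : fps_comp h (fps_comp b hinv) 0%N = 0 by rewrite fps_comp0.
  rewrite fps_compA ?fps_comp0 // [fps_comp (fps_comp a hinv) _]fps_compA //.
  by rewrite -[fps_comp hinv _]fps_compA // ih fps_Xcomp // [in RHS]fps_compA.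
by rewrite !conj_comp // gf.
Qed.

Lemma conjugateK (A : comNzRingType) (h hinv g : fps A) :
  tangent_to_id h -> fps_comp_inverse h hinv -> g 0%N = 0 ->
  fps_comp hinv (fps_comp (fps_comp h (fps_comp g hinv)) h) = g.
Proof.
move=> [h0 _] [i0 _ ih] g0; rewrite fps_compA ?fps_comp0 //.
rewrite -fps_compA ?fps_comp0 // ih fps_Xcomp ?fps_comp0 //.
by rewrite fps_compA // ih fps_compX.
Qed.

Lemma fps_comp_inverse_sym (A : comNzRingType) (h hinv : fps A) :
  h 0%N = 0 -> fps_comp_inverse h hinv -> fps_comp_inverse hinv h.
Proof. by move=> h0 [_ hi ih]. Qed.

(** * The two inclusions between the centralizer and the conjugated flow *)

Unset Implicit Arguments.

Theorem corollary5p7 (K : fieldType) (R : realType) (abs : K -> R)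
  (charK : [pchar K] =i pred0)
  (abs_nonarch : nonarch_absval abs)
  (abs_nontrivial : nontrivial_absval abs)
  (abs_complete : absval_complete abs)
  (m : nat) (m_ge2 : (2 <= m)%N) (mu : K)
  (f : fps K) (f_analytic : analytic abs f)
  (f_form : forall n : nat, (n < 2 * m)%N ->
     f n = fps_X n + fps_Xn K m n + mu * fps_Xn K (2 * m - 1) n)
  (* v = x^m / (1 - (mu - m/2) x^(m-1)) *)
  (v : fps K)
  (v_def : fps_mul v (fun n => fps_Xn K 0 n
                        - (mu - m%:R / 2%:R) * fps_Xn K (m - 1) n)
           = fps_Xn K m)
  (T : fps {poly K}) (T_flow : is_flow v T)
  (h hinv : fps K) (h_analytic : analytic abs h) (h_tangent : tangent_to_id h)
  (hinvP : fps_comp_inverse h hinv)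
  (h_conj : fps_comp h (fps_comp f hinv) = flow_at T 1) :
  analytic_centralizer abs f
  = [set fps_comp hinv (fps_comp (flow_at T t) h) | t in [set: K]]%classic.
Proof.
set c := mu - _ in v_def.
have vE := vector_field_coef m_ge2 v_def.
have v_low n : (n < m)%N -> v n = 0.
  elim/ltn_ind: n => n IHn nm; rewrite vE /fps_Xn (_ : (n == m)%N = false) ?add0r; last by lia.
  by case: ltnP => // mn; rewrite IHn ?mulr0 //; lia.
have vm : v m = 1.
  rewrite vE /fps_Xn eqxx (_ : (m < m.-1)%N = false); last by lia.
  by rewrite v_low ?mulr0 ?addr0 //; lia.
have v_rec n : (m < n)%N -> v n = c * v (n - m.-1)%N.
  move=> mn; rewrite vE /fps_Xn (_ : (n == m)%N = false); last by lia.
  by rewrite (_ : (n < m.-1)%N = false) ?add0r //; lia.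
have [v0 v1] : v 0%N = 0 /\ v 1%N = 0 by rewrite !v_low //; lia.
have T_low n : (n < m)%N -> T n = (fps_X n)%:P by exact: flow_coef_lt v_low.
have Tm : T m = 'X by exact: flow_coef_eq v_low vm.
have [T0 dT initT] := T_flow.
have T_tangent t : tangent_to_id (flow_at T t).
  by rewrite /tangent_to_id /flow_at !T_low ?hornerC //; lia.
have T_bounded t : geom_bounded abs (flow_at T t).
  exact: flow_geom_bounded v_low vm v_rec T_flow.
have hinv_tangent := tangent_to_id_inverse h_tangent hinvP.
have h_bounded := analytic_geom_bounded abs_nonarch abs_nontrivial h_analytic h_tangent.
have hinv_bounded := inverse_geom_bounded abs_nonarch h_tangent hinvP h_bounded.
have [h0 h1] := h_tangent; have [i0 i1] := hinv_tangent.
have hinvP' := fps_comp_inverse_sym h0 hinvP.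
have f0 : f 0%N = 0.
  rewrite f_form; last by lia.
  rewrite /fps_X /fps_Xn (_ : (0 == m)%N = false); last by lia.
  by rewrite (_ : (0 == 2 * m - 1)%N = false) ?mulr0 ?addr0 //; lia.
have T_comm t : fps_comp (flow_at T t) (flow_at T 1) = fps_comp (flow_at T 1) (flow_at T t).
  by rewrite !(flow_atD charK _ _ v1 T_flow) addrC.
apply/seteqP; split=> [g [_ g_tangent gf] | _ [t _ <-]].
  have [g0 g1] := g_tangent.
  set G := fps_comp h (fps_comp g hinv).
  have G_tangent : tangent_to_id G by do 2!apply: tangent_to_id_comp => //.
  (* The coefficient of [T^t] at [x^m] is [t], so this is the only possible time. *)
  exists (G m) => //.
  suff <- : G = flow_at T (G m) by exact: conjugateK.
  apply: (@commuting_series_eq _ charK m (flow_at T 1)) => //.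
  - by move=> i /andP[i1' im]; rewrite /flow_at T_low // hornerC; case: i i1' {im} => [|[]].
  - by rewrite /flow_at Tm hornerX.
  - by rewrite -h_conj; apply: conjugate_comm.
  - by rewrite /flow_at Tm hornerX.
(* Conversely, [f] is the conjugate of [T^1] by [hinv], so commutation carries over from the
   flow. *)
have fE : f = fps_comp hinv (fps_comp (flow_at T 1) h) by rewrite -h_conj conjugateK.
split.
- apply: (geom_bounded_analytic abs_nonarch abs_complete).
  apply: (comp_geom_bounded abs_nonarch) => //; first by rewrite fps_comp0 (T_tangent t).1.
  exact: comp_geom_bounded.
- by do 2!apply: tangent_to_id_comp => //.
- by rewrite fE; apply: conjugate_comm => //; rewrite (T_tangent _).1.
Qed.
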